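(* Let $\boldsymbol x\in L^2(\Omega,\mathbb R^m)$ and let $\boldsymbol v_1,\ldots,\boldsymbol v_p\in L^2(\Omega,\mathbb R^n)$ be pairwise orthogonal, i.e. $\mathbb E_{v_iv_j}=\mathbb O$ for $i\neq j$ (e.g. obtained by Lemma 3; the matrices $\mathbb E_{v_kv_k}$ need not be invertible). Let $\eta_1,\ldots,\eta_p$ be nonnegative integers with $\eta_1+\cdots+\eta_p\le\min\{m,n\}$. For each $k$ let $$\mathbb E_{xv_k}(\mathbb E_{v_kv_k}^{1/2})^\dagger=\sum_{j=1}^{r_k}\beta_{kj}s_{kj}d_{kj}^T$$ be a singular value decomposition with $\beta_{k1}\ge\cdots\ge\beta_{kr_k}>0$ ($\beta_{kj}:=0$ for $j>r_k$), and let $G_{k\eta_k}=\sum_{j=1}^{\eta_k}\beta_{kj}s_{kj}d_{kj}^T$. Set $$F_k^0=G_{k\eta_k}(\mathbb E_{v_kv_k}^{1/2})^\dagger+A_k\big[I-\mathbb E_{v_kv_k}^{1/2}(\mathbb E_{v_kv_k}^{1/2})^\dagger\big],\qquad f^0=E[\boldsymbol x]-\sum_{k=1}^pF_k^0E[\boldsymbol v_k],$$ where $A_k\in\mathbb R^{m\times n}$ is any matrix such that $\operatorname{rank}F_k^0\le\eta_k$ (e.g. $A_k=\mathbb O$). Then $(f^0,F_1^0,\ldots,F_p^0)$ minimizes $J(f,F_1,\ldots,F_p)=E\big[\|\boldsymbol x-f-\sum_{k=1}^pF_k\boldsymbol v_k\|^2\big]$ over all $f\in\mathbb R^m$ and $F_k\in\mathbb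 R^{m\times n}$ with $\operatorname{rank}F_k\le\eta_k$, and $$E\Big[\big\|\boldsymbol x-f^0-\textstyle\sum_{k=1}^pF_k^0\boldsymbol v_k\big\|^2\Big]=\|\mathbb E_{xx}^{1/2}\|^2-\sum_{k=1}^p\sum_{j=1}^{\eta_k}\beta_{kj}^2 .$$
   Context: $(\Omega,\Sigma,\mu)$ is a probability space, $E[\cdot]$ denotes expectation. For random vectors $\boldsymbol g,\boldsymbol h$, $\mathbb E_{gh}:=E[\boldsymbol g\boldsymbol h^T]-E[\boldsymbol g]E[\boldsymbol h]^T$. $M^\dagger$ is the Moore–Penrose pseudo-inverse; $M^{1/2}$ is the symmetric positive semidefinite square root of a symmetric PSD matrix $M$. For vectors $\|\cdot\|$ is the Euclidean norm, for matrices the Frobenius norm, so $\|\mathbb E_{xx}^{1/2}\|^2=\operatorname{tr}\mathbb E_{xx}$. Matrices act on random vectors pointwise in $\omega$. *)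

(* Defs.v *)
From HB Require Import structures.
From mathcomp Require Import all_boot all_order all_algebra.
From mathcomp Require Import all_classical all_reals all_analysis.
Set Implicit Arguments. Unset Strict Implicit. Unset Printing Implicit Defensive.
Import Order.TTheory GRing.Theory Num.Theory.
Local Open Scope ring_scope.

Section defs.
Context {d : measure_display} {T : measurableType d} {R : realType}.
Variable P : probability T R.

Definition L2vec (m : nat) (g : T -> 'cV[R]_m) : Prop :=
  forall i : 'I_m, (fun w => g w i ord0) \in Lfun P 2%:E.

Definition Emx (a b : nat) (X : T -> 'M[R]_(a, b)) : 'M[R]_(a, b) :=
  \matrix_(i, j) fine ('E_P[fun w => X w i j])%E.

Definition Ecov (a b : nat) (g : T -> 'cV[R]_a) (h : T -> 'cV[R]_b)
  : 'M[R]_(a, b) :=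
  Emx (fun w => g w *m (h w)^T) - Emx g *m (Emx h)^T.

Definition sqnorm (a : nat) (u : 'cV[R]_a) : R := \sum_(i < a) u i ord0 ^+ 2.

Definition Jobj (m n p : nat) (x : T -> 'cV[R]_m) (v : 'I_p -> T -> 'cV[R]_n)
  (f : 'cV[R]_m) (F : 'I_p -> 'M[R]_(m, n)) : \bar R :=
  ('E_P[fun w => sqnorm (x w - f - \sum_(k < p) F k *m v k w)])%E.
End defs.

Definition sqfrob {R : realType} (a b : nat) (M : 'M[R]_(a, b)) : R :=
  \sum_(i < a) \sum_(j < b) M i j ^+ 2.

Definition psd {R : realType} (a : nat) (M : 'M[R]_a) : Prop :=
  M^T = M /\ forall u : 'cV[R]_a, 0 <= (u^T *m M *m u) ord0 ord0.

Definition is_psd_sqrt {R : realType} (a : nat) (M S : 'M[R]_a) : Prop :=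
  psd S /\ S *m S = M.

Definition is_MP_pinv {R : realType} (a b : nat) (A : 'M[R]_(a, b))
  (X : 'M[R]_(b, a)) : Prop :=
  [/\ A *m X *m A = A, X *m A *m X = X,
      (A *m X)^T = A *m X & (X *m A)^T = X *m A].

Definition sv_ext {R : realType} (r : nat) (beta : nat -> R) (j : nat) : R :=
  if (j < r)%N then beta j else 0.

Definition Gtrunc {R : realType} (m n : nat) (r : nat) (beta : nat -> R)
  (s : nat -> 'cV[R]_m) (dd : nat -> 'cV[R]_n) (eta : nat) : 'M[R]_(m, n) :=
  \sum_(j < eta) sv_ext r beta j *: (s j *m (dd j)^T).

Definition is_svd {R : realType} (m n : nat) (M : 'M[R]_(m, n)) (r : nat)
  (beta : nat -> R) (s : nat -> 'cV[R]_m) (dd : nat -> 'cV[R]_n) : Prop :=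
  [/\ M = \sum_(j < r) beta j *: (s j *m (dd j)^T),
      forall j, (j < r)%N -> 0 < beta j,
      forall i j, (i <= j)%N -> (j < r)%N -> beta j <= beta i,
      forall i j, (i < r)%N -> (j < r)%N ->
        ((s i)^T *m s j) ord0 ord0 = (i == j)%:R &
      forall i j, (i < r)%N -> (j < r)%N ->
        ((dd i)^T *m dd j) ord0 ord0 = (i == j)%:R].

(* Main.v *)
(* After centring, and because the [v k] are uncorrelated, the objective splits as
   [J(f, F) = |bias|^2 + tr E_xx + sum_k (|F_k S_k - M_k|^2 - |M_k|^2)] with
   [S_k = E_kk^(1/2)] and [M_k = E_xk S_k^+].  This completion of the square needs
   [E_xk S_k^+ S_k = E_xk], that is [ker E_kk <= ker E_xk]: a component of [v k]
   with zero covariance is uncorrelated with [x].  Each summand is then a separate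
   best low-rank approximation problem, solved by the truncated singular value
   decomposition (Eckart-Young). *)
Require Import Defs.
From HB Require Import structures.
From mathcomp Require Import all_boot all_order all_algebra.
From mathcomp Require Import all_classical all_reals all_analysis.
From mathcomp Require Import ring lra.
Set Implicit Arguments. Unset Strict Implicit. Unset Printing Implicit Defensive.
Import Order.TTheory GRing.Theory Num.Theory.
Local Open Scope ring_scope.

(** * Eckart-Young approximation and pseudo-inverses *)

Section LinearAlgebra.
Context {R : realType}.

Lemma sqfrobE m n (M : 'M[R]_(m, n)) : sqfrob M = \tr (M *m M^T).
Proof.
rewrite /sqfrob /mxtrace; apply: eq_bigr => i _; rewrite mxE.
by apply: eq_bigr => j _; rewrite mxE expr2.
Qed.

Lemma sqfrob_ge0 m n (M : 'M[R]_(m, n)) : 0 <= sqfrob M.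
Proof. by apply: sumr_ge0 => i _; apply: sumr_ge0 => j _; exact: sqr_ge0. Qed.

Lemma sqfrob_eq0 m n (M : 'M[R]_(m, n)) : sqfrob M = 0 -> M = 0.
Proof.
move=> M0; apply/matrixP => i j; rewrite mxE; apply/eqP; rewrite -sqrf_eq0.
have row0 : \sum_j M i j ^+ 2 == 0.
  move/eqP: M0; rewrite psumr_eq0; last first.
    by move=> k _; apply: sumr_ge0 => l _; exact: sqr_ge0.
  by move/allP/(_ i); rewrite mem_index_enum; exact.
move: row0; rewrite psumr_eq0; last by move=> k _; exact: sqr_ge0.
by move/allP/(_ j); rewrite mem_index_enum; exact.
Qed.

Lemma mxtrace_mul_trmxC m n (A B : 'M[R]_(m, n)) :
  \tr (A *m B^T) = \tr (B *m A^T).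
Proof. by rewrite -mxtrace_tr trmx_mul trmxK. Qed.

Lemma sqfrobB m n (A B : 'M[R]_(m, n)) :
  sqfrob (A - B) = sqfrob A - 2 * \tr (A *m B^T) + sqfrob B.
Proof.
rewrite !sqfrobE linearB /= mulmxBl !mulmxBr !raddfB /=.
by rewrite (mxtrace_mul_trmxC B A); ring.
Qed.

(** If [u *m C^T *m C = 0], multiplying by [u^T] shows that [u *m C^T] has norm zero; a left inverse
    of [C] then forces [u = 0]. *)
Lemma row_full_gram_unit m r (C : 'M[R]_(m, r)) :
  row_full C -> C^T *m C \in unitmx.
Proof.
case/row_fullP => B BC1; rewrite -row_free_unit; apply: inj_row_free => u uCC.
have /sqfrob_eq0 uC : sqfrob (u *m C^T) = 0.
  by rewrite sqfrobE trmx_mul trmxK mulmxA -(mulmxA u) uCC mul0mx linear0.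
by rewrite -[u]mulmx1 -trmx1 -BC1 trmx_mul mulmxA uC mul0mx.
Qed.

(** From a full-rank factorization [B = C *m D] take the least-squares projector [C (C^T C)^-1 C^T]
    onto the column space. Cyclicity of the trace reduces its trace to that of the identity of size
    [\rank B]. *)
Lemma orthogonal_projector_exists m n (B : 'M[R]_(m, n)) :
  exists Q : 'M[R]_m,
    [/\ Q^T = Q, Q *m Q = Q, Q *m B = B & \tr Q = (\rank B)%:R].
Proof.
have: row_full (col_base B) by exact: col_base_full.
have: col_base B *m row_base B = B by exact: mulmx_base.
move: (\rank B) (col_base B) (row_base B) => k C D CD /row_full_gram_unit uG.
exists (C *m invmx (C^T *m C) *m C^T); split.
- by rewrite !trmx_mul trmxK trmx_inv trmx_mul trmxK mulmxA.
- by rewrite !mulmxA -(mulmxA _ C^T C) -(mulmxA C) mulVmx // mulmx1.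
- rewrite -CD !mulmxA.
  by rewrite -(mulmxA _ C^T C) -(mulmxA C) mulVmx // mulmx1.
- by rewrite mxtrace_mulC mulmxA mulmxV ?mxtrace1.
Qed.

Lemma sqfrob_projmx m n (Q : 'M[R]_m) (M : 'M[R]_(m, n)) :
  Q^T = Q -> Q *m Q = Q -> sqfrob (Q *m M) = \tr (Q *m M *m M^T).
Proof.
move=> Qt QQ; rewrite sqfrobE trmx_mul Qt mulmxA mxtrace_mulC !mulmxA.
by rewrite QQ.
Qed.

(** The cross term of [M] with [Q *m M] is again the squared norm of [Q *m M], because [Q] is an
    orthogonal projector. *)
Lemma sqfrob_pythagoras m n (Q : 'M[R]_m) (M : 'M[R]_(m, n)) :
  Q^T = Q -> Q *m Q = Q -> sqfrob M = sqfrob (Q *m M) + sqfrob (M - Q *m M).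
Proof.
move=> Qt QQ; rewrite sqfrobB (mxtrace_mul_trmxC M) -sqfrob_projmx //; ring.
Qed.

(** Orthonormality of the [t i] kills the cross products. Taking the trace then gives inner products
    of matrices that share their singular vectors. *)
Lemma sum_rank1_inner m n r (a b : nat -> R)
    (s : nat -> 'cV[R]_m) (t : nat -> 'cV[R]_n) :
  (forall i j, (i < r)%N -> (j < r)%N ->
    ((t i)^T *m t j) ord0 ord0 = (i == j)%:R) ->
  (\sum_(i < r) a i *: (s i *m (t i)^T)) *m
    (\sum_(i < r) b i *: (s i *m (t i)^T))^T
  = \sum_(i < r) (a i * b i) *: (s i *m (s i)^T).
Proof.
move=> ort; rewrite mulmx_suml; apply: eq_bigr => i _.
rewrite raddf_sum mulmx_sumr (bigD1 i) //= big1 ?addr0 => [|j ji].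
  rewrite linearZ /= trmx_mul trmxK -scalemxAr -scalemxAl scalerA mulrC.
  rewrite -mulmxA (mulmxA _ (t i)) (mx11_scalar (_^T *m _)) ort // eqxx.
  by rewrite mul1mx.
rewrite linearZ /= trmx_mul trmxK -scalemxAr -scalemxAl.
rewrite -mulmxA (mulmxA _ (t j)) (mx11_scalar (_^T *m _)) ort //.
rewrite (_ : (i == j :> nat) = false); last first.
  by apply/negbTE; rewrite eq_sym.
by rewrite -scalemx1 scale0r mul0mx mulmx0 !scaler0.
Qed.

(** The matrix [U] is the orthogonal projector onto the span of the [s j]. The sum is the squared
    norm of [U *m Q], at most that of [Q], which is [\tr Q]. *)
Lemma sum_sqfrob_orthonormal_le m r (Q : 'M[R]_m) (s : nat -> 'cV[R]_m) :
  Q^T = Q -> Q *m Q = Q ->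
  (forall i j, (i < r)%N -> (j < r)%N ->
    ((s i)^T *m s j) ord0 ord0 = (i == j)%:R) ->
  \sum_(j < r) sqfrob (Q *m s j) <= \tr Q.
Proof.
move=> Qt QQ ort.
set U := \sum_(j < r) s j *m (s j)^T.
have Ut : U^T = U.
  rewrite /U raddf_sum; apply: eq_bigr => j _.
  by rewrite /= trmx_mul trmxK.
have UU : U *m U = U.
  have E : \sum_(j < r) 1 *: (s j *m (s j)^T) = U.
    by apply: eq_bigr => j _; rewrite scale1r.
  rewrite -{2}Ut -{1 2}E (sum_rank1_inner (fun=> 1) (fun=> 1)) // -[RHS]E.
  by apply: eq_bigr => j _; rewrite mulr1.
have -> : \sum_(j < r) sqfrob (Q *m s j) = sqfrob (U *m Q).
  rewrite sqfrob_projmx // Qt -mulmxA QQ mxtrace_mulC /U mulmx_sumr raddf_sum.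
  by apply: eq_bigr => j _; rewrite sqfrob_projmx // mulmxA.
have -> : \tr Q = sqfrob Q by rewrite sqfrobE Qt QQ.
by rewrite [leRHS](sqfrob_pythagoras Q Ut UU) lerDl sqfrob_ge0.
Qed.

(* Moving the weight [w] into the first [e] positions can only increase the sum:
   every [b j] with [j < e] dominates [b e], which dominates the later ones. *)
Lemma weighted_sum_le_head (r e : nat) (b w : nat -> R) :
  (forall j, (j < r)%N -> 0 <= b j) ->
  (forall i j, (i <= j)%N -> (j < r)%N -> b j <= b i) ->
  (forall j, (j < r)%N -> 0 <= w j <= 1) ->
  \sum_(j < r) w j <= e%:R ->
  \sum_(j < r) b j * w j <= \sum_(j < r | (j < e)%N) b j.
Proof.
move=> b0 bmono w01 wsum.
(* When [r <= e] the value [b e] lies outside the range covered by the hypotheses, so the bound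
   [w j <= 1] is used directly. *)
have [re|er] := leqP r e.
  rewrite [leRHS](eq_bigl predT) => [|j]; last first.
    by rewrite (leq_trans (ltn_ord j)).
  apply: ler_sum => j _; rewrite ler_piMr ?b0 //.
  by case/andP: (w01 j (ltn_ord j)).
(* Termwise exchange with threshold [b e]: below [e] the factor [w j - 1] is nonpositive and
   [b j >= b e]; from [e] on, [w j] is nonnegative and [b j <= b e]. Summing the right-hand sides
   gives [b e] times a nonpositive number. *)
have step (j : 'I_r) :
    b j * w j - (if (j < e)%N then b j else 0) <= b e * (w j - (j < e)%N%:R).
  have /andP[w0 w1] := w01 j (ltn_ord j).
  case: (ltnP j e) => je /=.
    have := bmono j e (ltnW je) er; nra.
  have := bmono e j je (ltn_ord j); nra.
rewrite [leRHS]big_mkcond -subr_le0 -sumrB.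
apply: le_trans (ler_sum _ (fun j _ => step j)) _.
rewrite -mulr_sumr sumrB; apply: mulr_ge0_le0; first exact: b0.
rewrite subr_le0; apply: le_trans wsum _.
rewrite -natr_sum ler_nat -[leqLHS]card_ord -sum1_card.
rewrite (big_ord_widen r (fun=> 1%N)) ?(ltnW er) // big_mkcond /=.
by apply: leq_sum => j _; case: ifP.
Qed.

(** Reconciles the two index ranges, whichever of [e] and [r] is larger: both sums are padded to
    [maxn e r], and [h 0 j = 0] makes the zero singular values harmless. *)
Lemma sum_sv_ext (V : nmodType) (r e : nat) (beta : nat -> R)
    (h : R -> nat -> V) :
  (forall j, h 0 j = 0) ->
  \sum_(j < e) h (sv_ext r beta j) j = \sum_(j < r | (j < e)%N) h (beta j) j.
Proof.
move=> h0; rewrite (big_ord_widen_cond (maxn e r) xpredT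
  (fun j => h (sv_ext r beta j) j)) ?leq_maxl //.
rewrite (big_ord_widen_cond (maxn e r) (fun j => j < e)%N
  (fun j => h (beta j) j)) ?leq_maxr //.
rewrite big_mkcond [RHS]big_mkcond; apply: eq_bigr => j _ /=.
by rewrite /sv_ext; case: (j < e)%N => //=; case: (j < r)%N.
Qed.

(** Truncation is an orthogonal projection: the inner product of the truncation with [M] is the
    squared norm of the truncation, so the residual is a difference of squared norms. *)
Lemma Gtrunc_residual m n (M : 'M[R]_(m, n)) r beta s t e :
  is_svd M r beta s t ->
  sqfrob (Gtrunc r beta s t e - M)
  = sqfrob M - \sum_(j < e) sv_ext r beta j ^+ 2.
Proof.
case=> ME _ _ orts ortt.
(* Coefficients set to zero from [e] on put the truncation and [M] over the same range [r], as
   [sum_rank1_inner] requires. *)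
pose a j := if (j < e)%N then beta j else 0.
have -> : Gtrunc r beta s t e = \sum_(j < r) a j *: (s j *m (t j)^T).
  rewrite /Gtrunc (@sum_sv_ext _ r e beta (fun b j => b *: (s j *m (t j)^T)));
    last by move=> j; rewrite scale0r.
  rewrite big_mkcond; apply: eq_bigr => j _; rewrite /a.
  by case: ifP => // _; rewrite scale0r.
have trsum (c : nat -> R) : \tr (\sum_(i < r) c i *: (s i *m (s i)^T))
    = \sum_(i < r) c i.
  rewrite raddf_sum; apply: eq_bigr => i _ /=.
  by rewrite mxtraceZ mxtrace_mulC /mxtrace big_ord1 orts // eqxx mulr1.
rewrite sqfrobB sqfrobE [X in _ - 2 * \tr (_ *m X^T)]ME !sum_rank1_inner //.
rewrite (trsum (fun i => a i * a i)) (trsum (fun i => a i * beta i)).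
rewrite (@sum_sv_ext _ r e beta (fun b j => b ^+ 2)); last first.
  by move=> j; rewrite expr0n.
have -> : \sum_(i < r) a i * a i = \sum_(i < r) a i * beta i.
  apply: eq_bigr => i _; rewrite /a; case: ifP => //; rewrite !mul0r //.
have -> : \sum_(i < r) a i * beta i = \sum_(i < r | (i < e)%N) beta i ^+ 2.
  rewrite [RHS]big_mkcond; apply: eq_bigr => i _; rewrite /a expr2.
  by case: ifP => //; rewrite mul0r.
ring.
Qed.

(* Lower half of the Eckart-Young theorem.  With [Q] the orthogonal projector
   onto the column space of [B], [|B - M|^2 >= |M|^2 - |Q M|^2], and
   [|Q M|^2 = sum_j beta_j^2 |Q s_j|^2] where the weights [|Q s_j|^2] lie in
   [0, 1] and add up to at most [tr Q = rank B]. *)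
Lemma low_rank_residual_ge m n (M B : 'M[R]_(m, n)) r beta s t e :
  is_svd M r beta s t -> (\rank B <= e)%N ->
  sqfrob M - \sum_(j < e) sv_ext r beta j ^+ 2 <= sqfrob (B - M).
Proof.
case=> ME beta_gt0 beta_mono orts ortt rkB.
have [Q [Qt QQ QB trQ]] := orthogonal_projector_exists B.
rewrite (@sum_sv_ext _ r e beta (fun b j => b ^+ 2)); last first.
  by move=> j; rewrite expr0n.
have QM : sqfrob (Q *m M) = \sum_(j < r) beta j ^+ 2 * sqfrob (Q *m s j).
  rewrite sqfrob_projmx // -mulmxA {1}ME {1}ME sum_rank1_inner //.
  rewrite mulmx_sumr raddf_sum; apply: eq_bigr => j _ /=.
  by rewrite -scalemxAr mxtraceZ sqfrob_projmx // mulmxA expr2.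
have QM_le : sqfrob (Q *m M) <= \sum_(j < r | (j < e)%N) beta j ^+ 2.
  rewrite QM (@weighted_sum_le_head r e (fun j => beta j ^+ 2)
    (fun j => sqfrob (Q *m s j))) //.
  - by move=> j _; exact: sqr_ge0.
  - move=> i j ij jr; have ir := leq_ltn_trans ij jr.
    by rewrite ler_pXn2r ?nnegrE ?beta_mono // ltW // beta_gt0.
  - move=> j jr; rewrite sqfrob_ge0 /=.
    have <- : sqfrob (s j) = 1.
      by rewrite sqfrobE mxtrace_mulC /mxtrace big_ord1 orts // eqxx.
    by rewrite [leRHS](sqfrob_pythagoras _ Qt QQ) lerDl sqfrob_ge0.
  - rewrite (le_trans (sum_sqfrob_orthonormal_le Qt QQ orts)) // trQ.
    by rewrite ler_nat.
(* Since [Q] fixes [B], the part of [B - M] orthogonal to the range of [Q] comes from [M] alone. *)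
have sqfrobN : sqfrob (B - M - Q *m (B - M)) = sqfrob (M - Q *m M).
  rewrite mulmxBr QB opprB addrCA (addrC B) addrK -opprB.
  by rewrite !sqfrobE linearN /= mulmxN mulNmx opprK.
have := sqfrob_pythagoras (B - M) Qt QQ.
have := sqfrob_pythagoras M Qt QQ.
have := sqfrob_ge0 (Q *m (B - M)).
by rewrite sqfrobN; lra.
Qed.

(** Transposing the Penrose equations of a symmetric [S] shows that [Sd^T] satisfies them with the
    two projectors [S *m Sd] and [Sd *m S] exchanged; these projectors coincide. *)
Lemma MP_pinv_sym_comm n (S Sd : 'M[R]_n) :
  S^T = S -> is_MP_pinv S Sd -> Sd^T = Sd /\ S *m Sd = Sd *m S.
Proof.
move=> St [e1 e2 e3 e4].
have c1 : S *m Sd^T = Sd *m S by rewrite -e4 trmx_mul St.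
have c2 : Sd^T *m S = S *m Sd by rewrite -e3 trmx_mul St.
have t1 : S *m Sd^T *m S = S.
  by have := congr1 trmx e1; rewrite !trmx_mul St mulmxA.
have t2 : Sd^T *m S *m Sd^T = Sd^T.
  by have := congr1 trmx e2; rewrite !trmx_mul St mulmxA.
have comm : S *m Sd = Sd *m S.
  (* Both projectors are symmetric, so transposing this identity reverses the product, which then
     collapses to [Sd *m S]. *)
  have prod : S *m Sd = Sd *m S *m (S *m Sd) by rewrite -c1 mulmxA t1.
  by rewrite -e3 prod trmx_mul e3 e4 -c1 mulmxA e1.
by split=> //; rewrite -t2 c2 comm -mulmxA c1 -comm mulmxA.
Qed.

End LinearAlgebra.

(** * Second moments of random vectors *)

Section SecondMoments.
Context {d : measure_display} {T : measurableType d} {R : realType}.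
Variable P : probability T R.

(** Integrability has to be carried along because [fine] sends an infinite expectation to 0, which
    would break the linearity of [Emx]. *)
Definition L1mx a b (X : T -> 'M[R]_(a, b)) : Prop :=
  forall i j, (fun w => X w i j) \in Lfun P 1.

Lemma fine_expectationD (f g : T -> R) : f \in Lfun P 1 -> g \in Lfun P 1 ->
  fine ('E_P[fun w => (f w + g w)%R])%E = fine ('E_P[f])%E + fine ('E_P[g])%E.
Proof.
move=> f1 g1; rewrite -fineD ?expectation_fin_num //.
by rewrite -expectationD.
Qed.

Lemma fine_expectationZ (c : R) (f : T -> R) : f \in Lfun P 1 ->
  fine ('E_P[fun w => (c * f w)%R])%E = c * fine ('E_P[f])%E.
Proof.
move=> f1; rewrite -[c in RHS]/(fine c%:E) -fineM ?expectation_fin_num //.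
rewrite -expectationZl //; congr (fine (expectation P _)).
by apply/funext => w /=; rewrite mulrC.
Qed.

Lemma Lfun_mull q (c : R) (f : T -> R) : (1 <= q)%R ->
  f \in Lfun P q%:E -> (fun w => c * f w) \in Lfun P q%:E.
Proof.
move=> q1 fq; rewrite (_ : (fun w => _) = c \o* f); first exact: Lfun_scale.
by apply/funext => w /=; rewrite mulrC.
Qed.

Lemma Lfun_add q (f g : T -> R) : (1 <= q)%R ->
  f \in Lfun P q%:E -> g \in Lfun P q%:E ->
  (fun w => f w + g w) \in Lfun P q%:E.
Proof.
rewrite -lee_fin => q1 fq gq; have [_ addP] := Lfun_addr_closed P q1.
exact: addP.
Qed.

Lemma Lfun_sumr q (I : Type) (rs : seq I) (f : I -> T -> R) : (1 <= q)%R ->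
  (forall i, f i \in Lfun P q%:E) ->
  (fun w => \sum_(i <- rs) f i w) \in Lfun P q%:E.
Proof.
move=> q1 fq; elim: rs => [|i rs IH].
  by under eq_fun do rewrite big_nil; exact: Lfun_cst.
by under eq_fun do rewrite big_cons; exact: Lfun_add.
Qed.

Lemma fine_expectation_sum (I : Type) (rs : seq I) (f : I -> T -> R) :
  (forall i, f i \in Lfun P 1) ->
  fine ('E_P[fun w => (\sum_(i <- rs) f i w)%R])%E
  = \sum_(i <- rs) fine ('E_P[f i])%E.
Proof.
move=> f1; elim: rs => [|i rs IH].
  rewrite big_nil; under eq_fun do rewrite big_nil.
  by rewrite (expectation_cst P 0).
rewrite big_cons -IH -fine_expectationD //; last exact: (Lfun_sumr _ (lexx 1)).
by under eq_fun do rewrite big_cons.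
Qed.

Lemma EmxD a b (X Y : T -> 'M[R]_(a, b)) : L1mx X -> L1mx Y ->
  Emx P (fun w => X w + Y w) = Emx P X + Emx P Y.
Proof.
move=> X1 Y1; apply/matrixP => i j; rewrite !mxE.
by under eq_fun do rewrite mxE; rewrite fine_expectationD.
Qed.

Lemma Emx_mull a b c (A : 'M[R]_(a, b)) (X : T -> 'M[R]_(b, c)) : L1mx X ->
  Emx P (fun w => A *m X w) = A *m Emx P X.
Proof.
move=> X1; apply/matrixP => i j; rewrite !mxE.
under eq_fun do rewrite mxE.
rewrite fine_expectation_sum; last first.
  by move=> k; exact: (Lfun_mull _ (lexx 1) (X1 k j)).
by apply: eq_bigr => k _; rewrite mxE fine_expectationZ.
Qed.

Lemma EmxN a b (X : T -> 'M[R]_(a, b)) : L1mx X ->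
  Emx P (fun w => - X w) = - Emx P X.
Proof.
move=> X1; have := Emx_mull (- 1%:M) X1; rewrite mulNmx mul1mx.
by under eq_fun do rewrite mulNmx mul1mx.
Qed.

Lemma Emx_tr a b (X : T -> 'M[R]_(a, b)) :
  Emx P (fun w => (X w)^T) = (Emx P X)^T.
Proof.
by apply/matrixP => i j; rewrite !mxE; under eq_fun do rewrite mxE.
Qed.

Lemma Emx_cst a b (C : 'M[R]_(a, b)) : Emx P (fun=> C) = C.
Proof. by apply/matrixP => i j; rewrite !mxE (expectation_cst P). Qed.

Lemma L1mx_outer a b (g : T -> 'cV[R]_a) (h : T -> 'cV[R]_b) :
  L2vec P g -> L2vec P h -> L1mx (fun w => g w *m (h w)^T).
Proof.
move=> g2 h2 i j; under eq_fun do rewrite mxE big_ord1 [(h _)^T _ _]mxE.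
exact: (Lfun2_mul_Lfun1 (g2 i) (h2 j)).
Qed.

Lemma L2vec_L1mx a (g : T -> 'cV[R]_a) : L2vec P g -> L1mx g.
Proof.
move=> g2 i j; rewrite (ord1 j); apply: Lfun_subset12 (g2 i).
exact: fin_num_measure.
Qed.

Lemma L2vecD a (g h : T -> 'cV[R]_a) :
  L2vec P g -> L2vec P h -> L2vec P (fun w => g w + h w).
Proof.
move=> g2 h2 i; under eq_fun do rewrite mxE.
by apply: Lfun_add => //; rewrite ler1n.
Qed.

Lemma L2vec_cst a (c : 'cV[R]_a) : L2vec P (fun=> c).
Proof. by move=> i; exact: Lfun_cst. Qed.

Lemma L2vec_mull a b (A : 'M[R]_(a, b)) (g : T -> 'cV[R]_b) :
  L2vec P g -> L2vec P (fun w => A *m g w).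
Proof.
move=> g2 i; under eq_fun do rewrite mxE.
apply: Lfun_sumr => [|k]; first by rewrite ler1n.
by apply: Lfun_mull (g2 k); rewrite ler1n.
Qed.

Lemma L2vecN a (g : T -> 'cV[R]_a) : L2vec P g -> L2vec P (fun w => - g w).
Proof.
move=> g2; have := L2vec_mull (- 1%:M) g2.
by under eq_fun do rewrite mulNmx mul1mx.
Qed.

Lemma L2vec_sum a (I : Type) (rs : seq I) (g : I -> T -> 'cV[R]_a) :
  (forall i, L2vec P (g i)) -> L2vec P (fun w => \sum_(i <- rs) g i w).
Proof.
move=> g2; elim: rs => [|i rs IH].
  by under eq_fun do rewrite big_nil; exact: L2vec_cst.
by under eq_fun do rewrite big_cons; exact: L2vecD.
Qed.

Lemma Emx_sum a (I : Type) (rs : seq I) (g : I -> T -> 'cV[R]_a) :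
  (forall i, L2vec P (g i)) ->
  Emx P (fun w => \sum_(i <- rs) g i w) = \sum_(i <- rs) Emx P (g i).
Proof.
move=> g2; elim: rs => [|i rs IH].
  by under eq_fun do rewrite big_nil; rewrite big_nil Emx_cst.
under eq_fun do rewrite big_cons; rewrite big_cons -IH EmxD //.
  exact: L2vec_L1mx.
by apply: L2vec_L1mx; exact: L2vec_sum.
Qed.

(** This symmetry reduces each rule for the right argument below to its counterpart for the left
    one. *)
Lemma Ecov_tr a b (g : T -> 'cV[R]_a) (h : T -> 'cV[R]_b) :
  (Ecov P g h)^T = Ecov P h g.
Proof.
rewrite /Ecov raddfB /= trmx_mul trmxK -Emx_tr.
by under eq_fun do rewrite trmx_mul trmxK.
Qed.

Lemma EcovDl a b (g1 g2 : T -> 'cV[R]_a) (h : T -> 'cV[R]_b) :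
  L2vec P g1 -> L2vec P g2 -> L2vec P h ->
  Ecov P (fun w => g1 w + g2 w) h = Ecov P g1 h + Ecov P g2 h.
Proof.
move=> L1 L2 Lh; rewrite /Ecov EmxD; [|exact: L2vec_L1mx..].
under eq_fun do rewrite mulmxDl.
by rewrite EmxD; [rewrite mulmxDl opprD addrACA|exact: L1mx_outer..].
Qed.

Lemma Ecov_mull a b c (A : 'M[R]_(c, a)) (g : T -> 'cV[R]_a)
    (h : T -> 'cV[R]_b) : L2vec P g -> L2vec P h ->
  Ecov P (fun w => A *m g w) h = A *m Ecov P g h.
Proof.
move=> Lg Lh; rewrite /Ecov Emx_mull; last exact: L2vec_L1mx.
under eq_fun do rewrite -mulmxA.
by rewrite Emx_mull ?mulmxBr ?mulmxA //; exact: L1mx_outer.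
Qed.

Lemma Ecov_mulr a b c (A : 'M[R]_(c, b)) (g : T -> 'cV[R]_a)
    (h : T -> 'cV[R]_b) : L2vec P g -> L2vec P h ->
  Ecov P g (fun w => A *m h w) = Ecov P g h *m A^T.
Proof. by move=> Lg Lh; rewrite -Ecov_tr Ecov_mull // trmx_mul Ecov_tr. Qed.

Lemma EcovDr a b (g : T -> 'cV[R]_a) (h1 h2 : T -> 'cV[R]_b) :
  L2vec P g -> L2vec P h1 -> L2vec P h2 ->
  Ecov P g (fun w => h1 w + h2 w) = Ecov P g h1 + Ecov P g h2.
Proof. by move=> *; rewrite -Ecov_tr EcovDl // raddfD /= !Ecov_tr. Qed.

Lemma EcovNl a b (g : T -> 'cV[R]_a) (h : T -> 'cV[R]_b) :
  L2vec P g -> L2vec P h -> Ecov P (fun w => - g w) h = - Ecov P g h.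
Proof.
move=> Lg Lh; have := Ecov_mull (- 1%:M) Lg Lh.
by rewrite mulNmx mul1mx; under eq_fun do rewrite mulNmx mul1mx.
Qed.

Lemma EcovNr a b (g : T -> 'cV[R]_a) (h : T -> 'cV[R]_b) :
  L2vec P g -> L2vec P h -> Ecov P g (fun w => - h w) = - Ecov P g h.
Proof. by move=> *; rewrite -Ecov_tr EcovNl // raddfN /= Ecov_tr. Qed.

Lemma Ecov_cstl a b (c : 'cV[R]_a) (h : T -> 'cV[R]_b) :
  L2vec P h -> Ecov P (fun=> c) h = 0.
Proof.
move=> Lh; rewrite /Ecov Emx_cst Emx_mull ?Emx_tr ?subrr // => i j.
by under eq_fun do rewrite mxE; exact: L2vec_L1mx.
Qed.

Lemma Ecov_subcstl a b (g : T -> 'cV[R]_a) (c : 'cV[R]_a)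
    (h : T -> 'cV[R]_b) : L2vec P g -> L2vec P h ->
  Ecov P (fun w => g w - c) h = Ecov P g h.
Proof.
move=> Lg Lh; have Lc : L2vec P (fun=> - c) by exact: L2vec_cst.
by rewrite EcovDl // Ecov_cstl // addr0.
Qed.

Lemma Ecov_subcstr a b (g : T -> 'cV[R]_a) (h : T -> 'cV[R]_b)
    (c : 'cV[R]_b) : L2vec P g -> L2vec P h ->
  Ecov P g (fun w => h w - c) = Ecov P g h.
Proof. by move=> Lg Lh; rewrite -Ecov_tr Ecov_subcstl // Ecov_tr. Qed.

Lemma EcovB a (g h : T -> 'cV[R]_a) : L2vec P g -> L2vec P h ->
  Ecov P (fun w => g w - h w) (fun w => g w - h w)
  = Ecov P g g - Ecov P g h - (Ecov P g h)^T + Ecov P h h.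
Proof.
move=> Lg Lh; have LNh : L2vec P (fun w => - h w) by exact: L2vecN.
rewrite EcovDl //; last exact: L2vecD.
by rewrite EcovDr // EcovDr // !EcovNl // !EcovNr // Ecov_tr opprK addrA.
Qed.

Lemma Ecov_suml a b (I : Type) (rs : seq I) (g : I -> T -> 'cV[R]_a)
    (h : T -> 'cV[R]_b) :
  (forall i, L2vec P (g i)) -> L2vec P h ->
  Ecov P (fun w => \sum_(i <- rs) g i w) h = \sum_(i <- rs) Ecov P (g i) h.
Proof.
move=> Lg Lh; elim: rs => [|i rs IH].
  by under eq_fun do rewrite big_nil; rewrite big_nil Ecov_cstl.
under eq_fun do rewrite big_cons; rewrite big_cons -IH EcovDl //.
exact: L2vec_sum.
Qed.

Lemma Ecov_sumr a b (I : Type) (rs : seq I) (g : T -> 'cV[R]_a)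
    (h : I -> T -> 'cV[R]_b) :
  L2vec P g -> (forall i, L2vec P (h i)) ->
  Ecov P g (fun w => \sum_(i <- rs) h i w) = \sum_(i <- rs) Ecov P g (h i).
Proof.
move=> Lg Lh; rewrite -Ecov_tr Ecov_suml // raddf_sum.
by apply: eq_bigr => i _; rewrite /= Ecov_tr.
Qed.

(** Variance plus squared bias. Square integrability makes the expectation finite, so the objective
    becomes a real number expressed through covariances. *)
Lemma expectation_sqnorm a (g : T -> 'cV[R]_a) : L2vec P g ->
  ('E_P[fun w => sqnorm (g w)])%E
  = (\tr (Ecov P g g) + sqnorm (Emx P g))%:E.
Proof.
move=> Lg.
have sq1 i : (fun w => g w i ord0 ^+ 2) \in Lfun P 1.
  by under eq_fun do rewrite expr2; exact: (Lfun2_mul_Lfun1 (Lg i) (Lg i)).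
rewrite -[LHS]fineK; last first.
  by apply: expectation_fin_num; exact: (Lfun_sumr _ (lexx 1)).
congr EFin; rewrite /sqnorm fine_expectation_sum // /Ecov raddfB /=.
rewrite {1}/mxtrace -[LHS]addr0 -addrA; congr (_ + _).
  apply: eq_bigr => i _; rewrite mxE.
  by under [in RHS]eq_fun do rewrite mxE big_ord1 [_^T _ _]mxE -expr2.
rewrite addrC; apply/esym/eqP; rewrite subr_eq0; apply/eqP.
apply: eq_bigr => i _.
by rewrite [in RHS]mxE big_ord1 [_^T _ _]mxE expr2.
Qed.

Lemma sqnorm0 a : sqnorm (0 : 'cV[R]_a) = 0.
Proof. by rewrite /sqnorm big1 // => i _; rewrite mxE expr0n. Qed.

(** Centring leaves the covariance unchanged and removes the bias, so the trace is the expectation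
    of a squared norm. *)
Lemma tr_Ecov_ge0 a (g : T -> 'cV[R]_a) : L2vec P g -> 0 <= \tr (Ecov P g g).
Proof.
move=> Lg.
have Lc : L2vec P (fun w => g w - Emx P g).
  by apply: L2vecD => //; exact: L2vec_cst.
have : (0 <= 'E_P[fun w => sqnorm (g w - Emx P g)%R])%E.
  by apply: expectation_ge0 => w; apply: sumr_ge0 => i _; exact: sqr_ge0.
rewrite expectation_sqnorm // lee_fin.
rewrite EmxD ?Emx_cst ?subrr; [|exact: L2vec_L1mx|]; last first.
  by apply: L2vec_L1mx; exact: L2vec_cst.
rewrite sqnorm0 addr0.
by rewrite Ecov_subcstl // Ecov_subcstr.
Qed.

End SecondMoments.

(** * Decomposition of the mean square error *)

Section Residual.
Context {d : measure_display} {T : measurableType d} {R : realType}.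
Variable P : probability T R.

(* If [h] has zero covariance then [tr (Ecov g g)] for [g = x + t C h] with
   [C = Ecov x h] is [tr (Ecov x x) + 2 t |C|^2], nonnegative for all real [t]. *)
Lemma Ecov_eq0 a b (x : T -> 'cV[R]_a) (h : T -> 'cV[R]_b) :
  L2vec P x -> L2vec P h -> Ecov P h h = 0 -> Ecov P x h = 0.
Proof.
move=> Lx Lh hh0; set C := Ecov P x h; apply: sqfrob_eq0.
have tr_ge0 (t : R) : 0 <= \tr (Ecov P x x) + 2 * t * sqfrob C.
  have Ltch : L2vec P (fun w => (t *: C) *m h w) by exact: L2vec_mull.
  have := tr_Ecov_ge0 (L2vecD Lx Ltch).
  rewrite EcovDl ?EcovDr //; [|exact: L2vecD..].
  rewrite !Ecov_mull ?Ecov_mulr // hh0 mul0mx mulmx0 addr0.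
  rewrite -(Ecov_tr P x h) -/C linearZ /= -scalemxAl -scalemxAr.
  by rewrite !mxtraceD !mxtraceZ (sqfrobE C); lra.
have [C0|CN0] := eqVneq (sqfrob C) 0; first exact: C0.
(* This value of [t] makes the supposedly nonnegative expression equal to -1. *)
have := tr_ge0 (- (\tr (Ecov P x x) + 1) / (2 * sqfrob C)).
have -> : 2 * (- (\tr (Ecov P x x) + 1) / (2 * sqfrob C)) * sqfrob C
    = - (\tr (Ecov P x x) + 1) by field.
by lra.
Qed.

(** [Q] projects orthogonally onto the kernel of [S], so [Q *m v w] has covariance [Q S S Q = 0] and
    is uncorrelated with [x]; hence [Ecov P x v *m Q = 0]. *)
Lemma Ecov_mul_pinv a b (x : T -> 'cV[R]_a) (v : T -> 'cV[R]_b) S Sd :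
  L2vec P x -> L2vec P v -> is_psd_sqrt (Ecov P v v) S -> is_MP_pinv S Sd ->
  Ecov P x v *m Sd *m S = Ecov P x v.
Proof.
move=> Lx Lv [[St _] SS] SSd; case: SSd => e1 _ e3 e4.
pose Q : 'M[R]_b := 1%:M - Sd *m S.
have Qt : Q^T = Q by rewrite /Q raddfB /= trmx1 e4.
have SQ : S *m Q = 0 by rewrite /Q mulmxBr mulmx1 mulmxA e1 subrr.
have : Ecov P x (fun w => Q *m v w) = 0.
  apply: Ecov_eq0 => //; first exact: L2vec_mull.
  rewrite Ecov_mull ?Ecov_mulr //; last exact: L2vec_mull.
  by rewrite -SS Qt -(mulmxA S) SQ !mulmx0.
rewrite Ecov_mulr // Qt /Q mulmxBr mulmx1 mulmxA => /eqP.
by rewrite subr_eq0 => /eqP.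
Qed.

(** Completion of the square: the cross term is the trace of [C *m Sd *m S *m F^T], where the
    hypothesis on [C] absorbs [Sd *m S]. *)
Lemma sqfrob_sqrt_residual m n (C : 'M[R]_(m, n)) (S Sd : 'M[R]_n)
    (F : 'M[R]_(m, n)) :
  S^T = S -> is_MP_pinv S Sd -> C *m Sd *m S = C ->
  sqfrob (F *m S - C *m Sd) - sqfrob (C *m Sd)
  = \tr (F *m (S *m S) *m F^T) - 2 * \tr (C *m F^T).
Proof.
move=> St SSd CE; have [Sdt _] := MP_pinv_sym_comm St SSd.
rewrite sqfrobB addrK sqfrobE trmx_mul St !mulmxA; congr (_ - 2 * _).
rewrite trmx_mul Sdt -(mulmxA F) -mxtrace_tr !trmx_mul trmxK St Sdt.
by rewrite CE.
Qed.

Lemma Ecov_residual m n p (x : T -> 'cV[R]_m) (v : 'I_p -> T -> 'cV[R]_n)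
    (f : 'cV[R]_m) (F : 'I_p -> 'M[R]_(m, n)) :
  L2vec P x -> (forall k, L2vec P (v k)) ->
  (forall i j : 'I_p, i != j -> Ecov P (v i) (v j) = 0) ->
  let y := fun w => x w - f - \sum_(k < p) F k *m v k w in
  \tr (Ecov P y y) = \tr (Ecov P x x) + \sum_(k < p)
    (\tr (F k *m Ecov P (v k) (v k) *m (F k)^T)
     - 2 * \tr (Ecov P x (v k) *m (F k)^T)).
Proof.
move=> Lx Lv ort y.
pose z w := \sum_(k < p) F k *m v k w.
have LF k : L2vec P (fun w => F k *m v k w) by exact: L2vec_mull.
have Lz : L2vec P z by exact: L2vec_sum.
have Lf : L2vec P (fun=> - f) by exact: L2vec_cst.
have Lxf : L2vec P (fun w => x w - f) by exact: L2vecD.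
have xz : Ecov P x z = \sum_(k < p) Ecov P x (v k) *m (F k)^T.
  by rewrite Ecov_sumr //; apply: eq_bigr => k _; rewrite Ecov_mulr.
have zz : Ecov P z z = \sum_(k < p) F k *m Ecov P (v k) (v k) *m (F k)^T.
  rewrite Ecov_suml //; apply: eq_bigr => i _; rewrite Ecov_sumr //.
  rewrite (bigD1 i) //= big1 ?addr0 => [|j ji]; rewrite Ecov_mull ?Ecov_mulr //.
    by rewrite mulmxA.
  by rewrite ort 1?eq_sym // mul0mx mulmx0.
have -> : Ecov P y y = Ecov P x x - Ecov P x z - (Ecov P x z)^T + Ecov P z z.
  rewrite -[y]/(fun w => x w - f - z w) EcovB //.
  by rewrite !Ecov_subcstl // !Ecov_subcstr.
have trN (A : 'M[R]_m) : \tr (- A) = - \tr A by exact: raddfN.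
have trS (A : 'I_p -> 'M[R]_m) : \tr (\sum_(k < p) A k) = \sum_(k < p) \tr (A k).
  exact: raddf_sum.
rewrite xz zz; move: (Ecov P x x) => X; rewrite !mxtraceD !trN mxtrace_tr.
rewrite !trS sumrB -mulr_sumr; ring.
Qed.

(** The vector [f] enters only the last, nonnegative term, and some [f] cancels it for any given
    [F]; what remains is a sum with one independent problem per [k]. *)
Lemma Jobj_eq m n p (x : T -> 'cV[R]_m) (v : 'I_p -> T -> 'cV[R]_n)
    (S Sd : 'I_p -> 'M[R]_n) (f : 'cV[R]_m) (F : 'I_p -> 'M[R]_(m, n)) :
  L2vec P x -> (forall k, L2vec P (v k)) ->
  (forall i j : 'I_p, i != j -> Ecov P (v i) (v j) = 0) ->
  (forall k, is_psd_sqrt (Ecov P (v k) (v k)) (S k)) ->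
  (forall k, is_MP_pinv (S k) (Sd k)) ->
  Jobj P x v f F =
    (\tr (Ecov P x x)
     + \sum_(k < p) (sqfrob (F k *m S k - Ecov P x (v k) *m Sd k)
                     - sqfrob (Ecov P x (v k) *m Sd k))
     + sqnorm (Emx P x - f - \sum_(k < p) F k *m Emx P (v k)))%:E.
Proof.
move=> Lx Lv ort SS SSd.
have LF k : L2vec P (fun w => F k *m v k w) by exact: L2vec_mull.
have Lf : L2vec P (fun=> - f) by exact: L2vec_cst.
have Lxf : L2vec P (fun w => x w + - f) by exact: L2vecD.
have Lz : L2vec P (fun w => - \sum_(k < p) F k *m v k w).
  by apply: L2vecN; exact: L2vec_sum.
rewrite /Jobj expectation_sqnorm; last exact: L2vecD.
rewrite Ecov_residual //; congr EFin; congr (_ + _ + _).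
  apply: eq_bigr => k _; have [[St _] SSE] := SS k.
  by rewrite sqfrob_sqrt_residual ?SSE // Ecov_mul_pinv.
rewrite EmxD; [|exact: L2vec_L1mx..].
rewrite EmxD; [|exact: L2vec_L1mx..].
rewrite Emx_cst; congr (sqnorm (_ + _)).
rewrite EmxN; last by apply: L2vec_L1mx; exact: L2vec_sum.
rewrite Emx_sum //; congr (- _); apply: eq_bigr => k _.
by rewrite Emx_mull //; exact: L2vec_L1mx.
Qed.

End Residual.

(** The rows of the truncation lie in the row space of [C *m Sd], on which the projector [Sd *m S]
    acts trivially. Consequently the truncation itself is attained in the form [F *m S]. *)
Lemma Gtrunc_mul_pinv (R : realType) m n (C : 'M[R]_(m, n)) (S Sd : 'M[R]_n)
    r beta s t e :
  S^T = S -> is_MP_pinv S Sd -> is_svd (C *m Sd) r beta s t ->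
  Gtrunc r beta s t e *m Sd *m S = Gtrunc r beta s t e.
Proof.
move=> St SSd [ME beta_gt0 _ orts _].
have [_ comm] := MP_pinv_sym_comm St SSd; case: SSd => _ e2 _ _.
rewrite /Gtrunc !mulmx_suml; apply: eq_bigr => j _.
rewrite /sv_ext; case: ltnP => jr; last by rewrite !scale0r !mul0mx.
(* A left singular vector extracts its row from the decomposition, exposing a trailing [Sd] that
   absorbs [Sd *m S] by commutation. *)
have tE : beta j *: (t j)^T = (s j)^T *m (C *m Sd).
  rewrite ME mulmx_sumr (bigD1 (Ordinal jr)) //= big1 ?addr0 => [|i ij].
    rewrite -scalemxAr mulmxA (mx11_scalar (_^T *m _)) orts // eqxx.
    by rewrite mul1mx.
  rewrite -scalemxAr mulmxA (mx11_scalar (_^T *m _)) orts //.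
  rewrite (_ : (j == i :> nat) = false).
    by rewrite -scalemx1 scale0r mul0mx scaler0.
  by apply/negbTE; rewrite eq_sym.
rewrite scalemxAr tE -!mulmxA; congr (_ *m (_ *m (_ *m _))).
by rewrite -comm mulmxA e2.
Qed.

(** * Optimality of the truncated filters and the error they attain *)

Theorem theorem2 (d : measure_display) (T : measurableType d) (R : realType)
  (P : probability T R) (m n p : nat)
  (x : T -> 'cV[R]_m) (v : 'I_p -> T -> 'cV[R]_n)
  (eta : 'I_p -> nat)
  (Sxx : 'M[R]_m) (S Sd : 'I_p -> 'M[R]_n)
  (r : 'I_p -> nat) (beta : 'I_p -> nat -> R)
  (s : 'I_p -> nat -> 'cV[R]_m) (dv : 'I_p -> nat -> 'cV[R]_n)
  (A : 'I_p -> 'M[R]_(m, n)) :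
  L2vec P x ->
  (forall k, L2vec P (v k)) ->
  (forall i j : 'I_p, i != j -> Ecov P (v i) (v j) = 0) ->
  (\sum_(k < p) eta k <= minn m n)%N ->
  is_psd_sqrt (Ecov P x x) Sxx ->
  (forall k, is_psd_sqrt (Ecov P (v k) (v k)) (S k)) ->
  (forall k, is_MP_pinv (S k) (Sd k)) ->
  (forall k, is_svd (Ecov P x (v k) *m Sd k) (r k) (beta k) (s k) (dv k)) ->
  let F0 := fun k : 'I_p =>
    Gtrunc (r k) (beta k) (s k) (dv k) (eta k) *m Sd k
    + A k *m (1%:M - S k *m Sd k) in
  let f0 := Emx P x - \sum_(k < p) F0 k *m Emx P (v k) in
  (forall k, (\rank (F0 k) <= eta k)%N) ->
  (forall (f : 'cV[R]_m) (F : 'I_p -> 'M[R]_(m, n)),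
      (forall k, (\rank (F k) <= eta k)%N) ->
      (Jobj P x v f0 F0 <= Jobj P x v f F)%E) /\
  Jobj P x v f0 F0 =
    (sqfrob Sxx - \sum_(k < p) \sum_(j < eta k) sv_ext (r k) (beta k) j ^+ 2)%:E.
Proof.
move=> Lx Lv ort _ [[Sxt _] SxE] SS SSd svd F0 f0 rkF0.
have JE f F := Jobj_eq f F Lx Lv ort SS SSd.
(* Right multiplication by [S k] annihilates the [A k] term, since [S k *m Sd k *m S k = S k]; the
   error is therefore the same for every admissible [A k]. *)
have F0S k : F0 k *m S k = Gtrunc (r k) (beta k) (s k) (dv k) (eta k).
  have [[St _] _] := SS k.
  rewrite mulmxDl (Gtrunc_mul_pinv _ St (SSd k) (svd k)) -mulmxA mulmxBl mul1mx.
  by case: (SSd k) => -> _ _ _; rewrite subrr mulmx0 addr0.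
have bias0 : Emx P x - f0 - \sum_(k < p) F0 k *m Emx P (v k) = 0.
  by rewrite /f0 opprB addrCA subrr addr0 subrr.
have J0 : Jobj P x v f0 F0 = (sqfrob Sxx
    - \sum_(k < p) \sum_(j < eta k) sv_ext (r k) (beta k) j ^+ 2)%:E.
  rewrite JE bias0 sqnorm0 addr0 sqfrobE Sxt SxE -sumrN; congr EFin.
  congr (_ + _); apply: eq_bigr => k _.
  by rewrite F0S (Gtrunc_residual _ (svd k)) addrC addKr.
split=> // f F rkF; rewrite J0 JE lee_fin sqfrobE Sxt SxE -addrA lerD2l.
rewrite -sumrN -[leLHS]addr0; apply: lerD; last first.
  by apply: sumr_ge0 => i _; exact: sqr_ge0.
(* With the competitor's squared bias bounded below by 0, each [k] is compared separately:
   [F k *m S k] has rank at most that of [F k], hence at most [eta k]. *)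
apply: ler_sum => k _; rewrite lerBrDr addrC.
by apply: (low_rank_residual_ge (svd k)); rewrite (leq_trans (mxrankM_maxl _ _)).
Qed.
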